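(* There exists a sequence of random variables $\{X_i\}_{i=1}^{\infty}$ (on a common probability space), each taking the values $+1$ and $-1$ with probability $\frac12$ each, which are pairwise independent, such that, with $S_n=\sum_{i=1}^{n}X_i$, the sequence $(S_n)_{n\ge 1}$ is bounded almost surely, i.e. $\mathbb{P}\left(\sup_{n\ge 1}|S_n|<\infty\right)=1$.
   Context: Pairwise independent means that $X_i$ and $X_j$ are independent for every $i\neq j$. The almost sure bound on $|S_n|$ is allowed to be random. *)

(* Defs.v *)
From HB Require Import structures.
From mathcomp Require Import all_boot all_order all_algebra.
From mathcomp Require Import all_classical all_reals all_analysis.

Set Implicit Arguments.
Unset Strict Implicit.
Unset Printing Implicit Defensive.

Import Order.TTheory GRing.Theory Num.Theory.
Import numFieldNormedType.Exports.

Local Open Scope classical_set_scope.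
Local Open Scope ring_scope.

Definition independent_RV (R : realType) (d d1 d2 : measure_display)
    (T : measurableType d) (T1 : measurableType d1) (T2 : measurableType d2)
    (P : probability T R) (X : {RV P >-> T1}) (Y : {RV P >-> T2}) : Prop :=
  forall (A : set T1) (B : set T2), measurable A -> measurable B ->
    P (X @^-1` A `&` Y @^-1` B) = (P (X @^-1` A) * P (Y @^-1` B))%E.

Definition pairwise_independent (R : realType) (d d' : measure_display)
    (T : measurableType d) (T' : measurableType d') (P : probability T R)
    (X : nat -> {RV P >-> T'}) : Prop :=
  forall i j : nat, i <> j -> independent_RV (X i) (X j).

Definition fair_sign (R : realType) (d : measure_display)
    (T : measurableType d) (P : probability T R) (X : {RV P >-> R}) : Prop :=
  P (X @^-1` [set 1]) = (2^-1)%:E /\ P (X @^-1` [set -1]) = (2^-1)%:E.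

(* Sequences are indexed from 0, so [X i] is the (i+1)-st variable and
   [partial_sum X n] is the sum of the first [n] of them. *)
Definition partial_sum (R : realType) (d : measure_display)
    (T : measurableType d) (P : probability T R) (X : nat -> {RV P >-> R})
    (n : nat) (w : T) : R :=
  \sum_(i < n) X i w.

(* Main.v *)
Require Import Defs.
From HB Require Import structures.
From mathcomp Require Import all_boot all_order all_algebra.
From mathcomp Require Import all_classical all_reals all_analysis.
From mathcomp Require Import measurable_realfun ring lra zify.
Import Order.TTheory GRing.Theory Num.Theory.
Import numFieldNormedType.Exports.
Local Open Scope classical_set_scope.
Local Open Scope ring_scope.

(** The variables are the nonconstant Walsh functions [w_1, w_2, ...] on the unit
    interval with Lebesgue measure, in their Paley enumeration: if [r_l x] is the
    sign [(-1)^b], with [b] the (l+1)-st binary digit of [x] after the point, then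
    [w_k] is the product of the [r_l] over the positions [l] of the binary digits
    1 of [k].

    Any product of the [r_l] over a nonempty finite set of positions is a fair
    sign, because its last factor is a fresh digit, equally likely to be 0 or 1
    given the earlier ones ([unif_odd_dyadic], [unif_rademacher_prod]).  For
    [i <> j] the product [w_i w_j] is again of this form: the positions are those
    where the binary expansions of [i] and [j] differ.  So [w_i], [w_j] and
    [w_i w_j] are all fair, and for signs this forces independence
    ([independent_signs]).

    Boundedness is the classical estimate of the Walsh-Dirichlet kernel
    [D_n = w_0 + ... + w_(n-1)].  Splitting the indices by parity gives
    [D_(2n) = (1 + r_0) D_n'], where the prime means that the sequence of signs
    has been shifted by one.  If [r_m x = -1], then after [m] such steps the factor
    [1 + r_m x] vanishes, and only boundary terms totalling less than [2^(m+1)]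
    survive ([walsh_sum_bounded]).  Every [x] strictly between 0 and 1 has a
    binary digit 1, so the partial sums are bounded at every such point; the bound
    depends on the position of the first digit 1, hence is random. *)

(** * Binary digits of natural numbers *)

Definition bit (k l : nat) : bool := odd (k %/ 2 ^ l).

Lemma bit_double0 (b : bool) k : bit (b + k.*2) 0 = b.
Proof. by rewrite /bit expn0 divn1 oddD odd_double addbF oddb. Qed.

Lemma bit_doubleS (b : bool) k l : bit (b + k.*2) l.+1 = bit k l.
Proof. by rewrite /bit expnS divnMA divn2 half_bit_double. Qed.

Lemma bit_ge k l : (k <= l)%N -> bit k l = false.
Proof.
by move=> kl; rewrite /bit divn_small// (leq_ltn_trans kl)// ltn_expl.
Qed.

(** The bound on [l] matters: it places the differing digit inside the range of the
    truncated products used below. *)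
Lemma bit_neq {N i j : nat} :
  (i < 2 ^ N)%N -> (j < 2 ^ N)%N -> i <> j ->
  exists2 l, (l < N)%N & bit i l != bit j l.
Proof.
elim: N i j => [|N IH] i j; first by case: i j => [|i] [|j].
rewrite -(odd_double_half i) -(odd_double_half j) expnS => iN jN ij.
have [oij|oij] := eqVneq (odd i) (odd j); last first.
  by exists 0%N => //; rewrite !bit_double0.
have [||hij|l lN bl] := IH i./2 j./2.
- lia.
- lia.
- by apply: ij; rewrite oij hij.
- by exists l.+1 => //; rewrite !bit_doubleS.
Qed.

(** * Walsh products and the Dirichlet kernel *)

Section Walsh.
Context {R : realDomainType}.
Implicit Types (r : nat -> R) (k m n : nat).

(** The positions of the digits 1 of [k] are all less than [k], so ranging over
    [l < k] loses nothing. *)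
Definition walsh r k : R := \prod_(l < k) r l ^+ bit k l.

Lemma walsh0 r : walsh r 0 = 1.
Proof. by rewrite /walsh big_ord0. Qed.

Lemma walsh_widen N r k : (k <= N)%N ->
  walsh r k = \prod_(l < N) r l ^+ bit k l.
Proof.
move=> kN; rewrite /walsh (big_ord_widen _ (fun l => r l ^+ bit k l) kN).
rewrite big_mkcond; apply: eq_bigr => l _.
by case: ltnP => // /bit_ge ->.
Qed.

(** Removing the lowest digit of the index shifts the sequence of signs: this
    self-similarity replaces all manipulation of binary expansions in the estimate
    of the kernel. *)
Lemma walsh_double r (b : bool) k :
  walsh r (b + k.*2) = r 0%N ^+ b * walsh (r \o succn) k.
Proof.
rewrite (@walsh_widen (b + k.*2).+1)// big_ord_recl bit_double0.
rewrite (@walsh_widen (b + k.*2) _ k); last by lia.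
by congr (_ * _); apply: eq_bigr => l _; rewrite bit_doubleS.
Qed.

Lemma walsh_sum_double r n :
  \sum_(k < n.*2) walsh r k = (1 + r 0%N) * \sum_(k < n) walsh (r \o succn) k.
Proof.
elim: n => [|n IH]; first by rewrite !big_ord0 mulr0.
rewrite doubleS !big_ord_recr/= IH.
rewrite -[n.*2]/(false + n.*2)%N -[(_ + _).+1]/(true + n.*2)%N !walsh_double.
by rewrite expr0 expr1; ring.
Qed.

Lemma walsh_norm r k : (forall l, `|r l| = 1) -> `|walsh r k| = 1.
Proof.
move=> r1; rewrite normr_prod big1// => l _.
by rewrite normrX r1 expr1n.
Qed.

(** Induction on [m]: an even-length sum of [n.*2] terms is [1 + r 0] times a sum
    for the shifted signs, whose entry [-1] is one place earlier.  The factor is 0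
    when [m = 0] and at most 2 otherwise, and an odd length costs one more term of
    norm 1.  The bounds [B_m] thus satisfy [B_0 = 1] and [B_(m+1) = 2 B_m + 1],
    which is solved by [2^(m+1) - 1]. *)
Lemma walsh_sum_bounded r m n : (forall l, `|r l| = 1) -> r m = -1 ->
  `|\sum_(k < n) walsh r k| <= 2 ^+ m.+1 - 1.
Proof.
elim: m r n => [|m IH] r n r1 rm.
all: have wn : `|walsh r n./2.*2| = 1 by exact: walsh_norm.
all: rewrite -(odd_double_half n).
all: have odd_tail : `|\sum_(k < odd n + n./2.*2) walsh r k|
    <= `|\sum_(k < n./2.*2) walsh r k| + 1
  by (case: (odd n); rewrite ?addnE/= ?lerDl//;
      rewrite -wn big_ord_recr; exact: ler_normD).
all: apply: (le_trans odd_tail); rewrite walsh_sum_double normrM.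
- by rewrite rm subrr normr0 mul0r expr1; lra.
- have := IH (r \o succn) n./2 (fun l => r1 l.+1) rm.
  have : `|1 + r 0%N| <= 2.
    by rewrite (le_trans (ler_normD _ _))// r1 normr1.
  have := normr_ge0 (1 + r 0%N).
  set a := `|1 + _|; set s := `|\sum_(_ < _) _|.
  have s0 : 0 <= s by exact: normr_ge0.
  rewrite [2 ^+ m.+2]exprS; set c := 2 ^+ m.+1.
  nra.
Qed.

End Walsh.

(** * Binary digits of real numbers and the uniform distribution *)

Section dyadic.
Context {R : realType}.
Implicit Types x : R.

(** For [0 <= x < 1], the number formed by the first [n] binary digits of [x]: its
    parity is the [n]-th digit, and halving it drops that digit. *)
Definition dyadic n x : nat := Num.truncn (2 ^+ n * x).

Lemma dyadic_half n x : (dyadic n.+1 x)./2 = dyadic n x.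
Proof.
rewrite /dyadic exprS -mulrA; set y := 2 ^+ n * x.
have [y0|y0] := leP 0 y; last first.
  by rewrite !(elimT (truncn0Pn _))// -ltNge; lra.
apply/esym/truncn_def.
have /andP[] : (Num.truncn (2 * y))%:R <= 2 * y < (Num.truncn (2 * y)).+1%:R.
  by apply: truncn_itv; lra.
set t := Num.truncn _.
rewrite -[in t%:R](odd_double_half t) -[in t.+1](odd_double_half t).
rewrite -addn1 -[X in _ < X%:R]addn1 -!muln2 !natrD !natrM.
by case: (odd t) => /= ? ?; apply/andP; split; lra.
Qed.

Lemma dyadic_eq n x i : 0 <= x ->
  (dyadic n x == i) = (i%:R / 2 ^+ n <= x < i.+1%:R / 2 ^+ n).
Proof.
move=> x0; rewrite truncn_eq ?mulr_ge0//.
by rewrite ler_pdivrMr// ltr_pdivlMr// mulrC.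
Qed.

Lemma measurable_dyadic n : measurable_fun setT (@dyadic n : R -> nat).
Proof.
move=> _ Y _; rewrite setTI.
rewrite (_ : _ @^-1` Y = \bigcup_(i in Y) (dyadic n @^-1` [set i])); last first.
  by apply/seteqP; split=> [x Yx|x [i Yi /= ->]//]; exists (dyadic n x).
apply: bigcup_measurable => i _.
have [->|i0] := eqVneq i 0%N.
  rewrite (_ : _ @^-1` _ = `]-oo, (2 ^+ n)^-1[%classic)//.
  apply/seteqP; split=> x /=; rewrite in_itv/=.
    move=> /truncn0Pn; rewrite -ltNge => ?.
    by rewrite -[X in _ < X]mul1r ltr_pdivlMr// mulrC.
  rewrite -[X in _ < X]mul1r ltr_pdivlMr// mulrC => ?.
  by apply/truncn0Pn; rewrite -ltNge.
rewrite (_ : _ @^-1` _ = `[i%:R / 2 ^+ n, i.+1%:R / 2 ^+ n[%classic)//.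
apply/seteqP; split=> x /=; rewrite in_itv/=.
  have [x0|x0] := leP 0 x; first by move=> /eqP; rewrite dyadic_eq.
  move=> di; move: i0; rewrite -di => /eqP[].
  by apply/truncn0Pn; rewrite -ltNge (lt_le_trans _ (@ler01 R))// pmulr_rlt0.
move=> xi; apply/eqP; rewrite dyadic_eq//.
by case/andP: xi => + _; apply: le_trans; rewrite divr_ge0.
Qed.

(** If all digits of [x] vanish, then so do all its dyadic truncations, whereas
    [1 <= 2 ^ n * x] for large [n]. *)
Lemma ex_odd_dyadic x : 0 < x < 1 -> exists m, odd (dyadic m.+1 x).
Proof.
move=> /andP[x0 x1]; apply: contrapT => /forallNP ev.
have d0 n : dyadic n x = 0%N.
  elim: n => [|n IH]; first by apply/truncn0Pn; rewrite expr0 mul1r -ltNge.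
  rewrite -(odd_double_half (dyadic n.+1 x)) dyadic_half IH.
  by move: (ev n) => /negP/negbTE ->.
have /truncn0Pn/negP := d0 (Num.truncn x^-1).+1; apply.
rewrite -ler_pdivrMr// mul1r (le_trans (ltW (truncnS_gt _)))//.
by rewrite -natrX ler_nat ltnW// ltn_expl.
Qed.

Definition rademacher x m : R := (-1) ^+ odd (dyadic m.+1 x).

Lemma rademacher_norm x m : `|rademacher x m| = 1.
Proof. exact: normr_sign. Qed.

(** A product of the first [N] Rademacher signs sees [x] only through its first [N]
    digits, whatever the next digit is. *)
Lemma rademacher_prod (c : nat -> bool) N :
  exists g : nat -> bool, forall x,
    \prod_(l < N) rademacher x l ^+ c l = (-1) ^+ g (dyadic N x).
Proof.
elim: N => [|N [g gE]]; first by exists (fun=> false) => x; rewrite big_ord0.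
exists (fun t => g t./2 (+) (c N && odd t)) => x.
rewrite big_ord_recr/= gE dyadic_half signr_addb; congr (_ * _).
by case: (c N).
Qed.

Definition unif : probability _ R := uniform_prob (@ltr01 R).

Lemma unifE (A : set R) : measurable A ->
  unif A = lebesgue_measure (A `&` `[0, 1]).
Proof.
move=> mA; rewrite /unif/= /uniform_prob integral_uniform_pdf.
rewrite (eq_integral (cst 1%E)); last first.
  move=> x; rewrite inE/= in_itv/= /uniform_pdf => -[_ ->].
  by rewrite subr0 invr1.
by rewrite integral_cst ?mul1e//=; exact: measurableI.
Qed.

Lemma unif_dyadic n i : (i < 2 ^ n)%N ->
  unif (dyadic n @^-1` [set i]) = (2 ^- n)%:E.
Proof.
move=> ltin.
have le1 : i.+1%:R / 2 ^+ n <= 1 :> R.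
  by rewrite ler_pdivrMr// mul1r -natrX ler_nat.
rewrite unifE; last first.
  by rewrite -[X in measurable X]setTI; exact: measurable_dyadic.
rewrite (_ : _ `&` _ = `[i%:R / 2 ^+ n, i.+1%:R / 2 ^+ n[%classic).
  rewrite lebesgue_measure_itv/= lte_fin ltr_pM2r ?invr_gt0// ltr_nat ltnSn.
  by rewrite -EFinB -mulrBl -natrB// subSnn mul1r.
apply/seteqP; split=> x /=; rewrite !in_itv/=.
  by move=> [/eqP + /andP[x0 _]]; rewrite dyadic_eq.
move=> ix; have /andP[ix1 ix2] := ix.
have x0 : 0 <= x by apply: le_trans ix1; rewrite divr_ge0.
split; first by apply/eqP; rewrite dyadic_eq.
by rewrite x0 (le_trans (ltW ix2)).
Qed.

Lemma measurable_dyadic_pred n (p : pred nat) :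
  measurable [set x : R | p (dyadic n x)].
Proof.
rewrite -[X in measurable X]setTI.
exact: (measurable_dyadic n measurableT [set k | p k]).
Qed.

(** The next digit is a fair coin independent of the first [m] ones, stated as: no
    guess [h] made from the first [m] digits is right with probability other than
    one half.  The event contains, for each prefix [i < 2 ^ m], the dyadic interval
    of prefix [h i + i.*2], and so has probability at least one half; the same
    bound for the opposite guess, which is the complementary event, gives
    equality. *)
Lemma unif_odd_dyadic m (h : nat -> bool) :
  unif [set x | odd (dyadic m.+1 x) = h (dyadic m x)] = (2^-1)%:E.
Proof.
pose E (g : nat -> bool) := [set x : R | odd (dyadic m.+1 x) == g (dyadic m x)].
have EE g : E g = [set x : R | odd (dyadic m.+1 x) = g (dyadic m x)].
  by apply/seteqP; split=> x /eqP.
have mE g : measurable (E g).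
  have := measurable_dyadic_pred m.+1 (fun t => odd t == g t./2).
  by under eq_set do rewrite /= dyadic_half.
have lbE g : ((2^-1)%:E <= unif (E g))%E.
  pose F (i : 'I_(2 ^ m)) := dyadic m.+1 @^-1` [set (g i + i.*2)%N] : set R.
  have mF i : measurable (F i).
    rewrite -[F i]setTI; exact: measurable_dyadic.
  have uF i : unif (F i) = (2 ^- m.+1)%:E.
    apply: unif_dyadic; rewrite expnS.
    by have := ltn_ord i; case: (g i) => /=; lia.
  have tF : trivIset setT F.
    apply/trivIsetP => i j _ _ ij; apply/seteqP; split=> x //= [].
    rewrite /F/= => ->.
    move=> /(congr1 half); rewrite !half_bit_double => /val_inj ijE.
    by rewrite ijE eqxx in ij.
  have <- : unif (\big[setU/set0]_(i < 2 ^ m) F i) = (2^-1)%:E.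
    rewrite measure_bigsetU_ord//.
    rewrite (eq_bigr (fun=> (2 ^- m.+1)%:E)); last by move=> i _; exact: uF.
    rewrite sumEFin sumr_const card_ord -[_ *+ (2 ^ m)]mulr_natl natrX.
    by rewrite exprS invfM mulrCA divff ?mulr1// expf_neq0.
  apply: le_measure; rewrite ?inE//.
  - by apply: bigsetU_measurable => i _; exact: mF.
  - exact: mE.
  rewrite -bigcup_seq => x [i _].
  rewrite /E/= -(@dyadic_half m) => ->.
  by rewrite half_bit_double oddD odd_double addbF oddb.
rewrite -EE; apply/eqP; rewrite eq_le lbE andbT.
have := lbE (fun t => ~~ h t).
have -> : E (fun t => ~~ h t) = ~` E h.
  apply/seteqP; split=> x; rewrite /E/=; last by move/negP; case: odd; case: h.
  by case: odd; case: h.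
rewrite probability_setC; last exact: mE.
have /fineK <- := fin_num_measure unif _ (mE h).
by rewrite -EFinB !lee_fin; lra.
Qed.

(** At the largest [l] with [c l], the factor [rademacher x l] is a fair coin
    independent of the product of the previous factors. *)
Lemma unif_rademacher_prod (c : nat -> bool) N (b : bool) :
  (exists2 l, (l < N)%N & c l) ->
  unif [set x | \prod_(l < N) rademacher x l ^+ c l = (-1) ^+ b]
    = (2^-1)%:E.
Proof.
elim: N => [[]//|N IH] cN.
case cNE: (c N); last first.
  rewrite -IH; last first.
    have [l + cl] := cN; rewrite ltnS leq_eqVlt => /predU1P[lN|lN].
      by rewrite -lN cl in cNE.
    by exists l.
  by under eq_set do rewrite big_ord_recr/= cNE mulr1.
have [g gE] := rademacher_prod c N.
rewrite -(unif_odd_dyadic N (fun t => g t (+) b)).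
congr (unif _); apply/seteqP; split=> x /=;
  rewrite big_ord_recr/= gE cNE expr1 -signr_addb.
- move=> /signr_inj <-; by case: (g _); case: odd.
- by move=> ->; congr (_ ^+ nat_of_bool _); case: (g _); case: (b).
Qed.

End dyadic.

(** * Independence of two signs *)

Section fair_signs.
Context {R : realType} {d : measure_display} {T : measurableType d}
  {P : probability T R}.
Implicit Types (X Y : {RV P >-> R}) (A B : set R) (E : set T).

Definition sign_valued X := forall w, X w = 1 \/ X w = -1.

Lemma measurable_RV X A : measurable A -> measurable (X @^-1` A).
Proof.
by move=> mA; rewrite -[X in measurable X]setTI; apply: measurable_funPT.
Qed.

(** Reduces an arbitrary measurable [A] to the two values that [X] can take; used
    with [E] the whole space and with [E] an event of the other variable. *)
Lemma sign_split X A E : sign_valued X -> measurable E ->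
  (P (X @^-1` A `&` E) =
    (1%R \in A)%:R%:E * P (X @^-1` [set 1%R] `&` E) +
    ((-1)%R \in A)%:R%:E * P (X @^-1` [set (-1)%R] `&` E))%E.
Proof.
move=> sX mE.
have m1 a : measurable (X @^-1` [set a] `&` E).
  by apply: measurableI => //; exact: measurable_RV.
have -> : X @^-1` A `&` E =
    (if 1 \in A then X @^-1` [set 1] `&` E else set0) `|`
    (if -1 \in A then X @^-1` [set -1] `&` E else set0).
  apply/seteqP; split=> w /=.
    move=> [AX Ew]; have [Xw|Xw] := sX w; rewrite Xw in AX.
      by left; rewrite mem_set.
    by right; rewrite mem_set.
  by case: ifPn => [/set_mem A1|_]; case: ifPn => [/set_mem A2|_];
    move=> [] // [/= ->].
rewrite measureU.
- by congr (_ + _)%E; case: ifP; rewrite ?mul1e ?mul0e ?measure0.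
- by case: ifP.
- by case: ifP.
- case: ifP; case: ifP => _ _; rewrite ?setI0 ?set0I//.
  apply/seteqP; split=> w //= [[-> _] [e _]].
  by move: e; lra.
Qed.

(** The four joint probabilities [q a b] are determined by the fairness of [X], of
    [Y] and of the product: each row, each column and the diagonal of the
    two-by-two table sum to one half, so that all entries are one quarter. *)
Lemma independent_signs X Y : sign_valued X -> sign_valued Y ->
  fair_sign X -> fair_sign Y ->
  P [set w | X w * Y w = 1] = (2^-1)%:E -> independent_RV X Y.
Proof.
move=> sX sY [X1 XN] [Y1 YN] XY A B mA mB.
have mX a : measurable (X @^-1` [set a]) by exact: measurable_RV.
have mY a : measurable (Y @^-1` [set a]) by exact: measurable_RV.
have mYB : measurable (Y @^-1` B) by exact: measurable_RV.
pose q a b := fine (P (X @^-1` [set a] `&` Y @^-1` [set b])).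
have qE a b : P (X @^-1` [set a] `&` Y @^-1` [set b]) = (q a b)%:E.
  by rewrite fineK// fin_num_measure//; exact: measurableI.
have QX a : P (X @^-1` [set a]) = (q a 1 + q a (-1))%:E.
  rewrite -[X @^-1` _]setTI -(preimage_setT Y) sign_split// !mem_setT !mul1e.
  by rewrite setIC qE setIC qE EFinD.
have QY b : P (Y @^-1` [set b]) = (q 1 b + q (-1) b)%:E.
  rewrite -[Y @^-1` _]setTI -(preimage_setT X) sign_split// !mem_setT !mul1e.
  by rewrite !qE EFinD.
have QXY : (2^-1)%:E = (q 1 1 + q (-1) (-1))%:E.
  rewrite -XY EFinD -!qE -measureU; last first.
  - apply/seteqP; split=> w //= [[-> _] [e _]].
    by move: e; lra.
  - exact: measurableI.
  - exact: measurableI.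
  congr (P _); apply/seteqP; split=> w /=; last first.
    by move=> [[-> ->]|[-> ->]]; rewrite ?mulr1// mulrNN mulr1.
  have [->|->] := sX w; have [->|->] := sY w; rewrite ?mulr1 ?mulN1r ?mul1r.
  - by left.
  - by move=> e; exfalso; move: e; lra.
  - by move=> e; exfalso; move: e; lra.
  - by right.
move: X1 XN Y1 YN QXY; rewrite !QX !QY => -[X1] [XN] [Y1] [YN] [QXY].
have q11 : q 1 1 = 4^-1 by lra.
have q1N : q 1 (-1) = 4^-1 by lra.
have qN1 : q (-1) 1 = 4^-1 by lra.
have qNN : q (-1) (-1) = 4^-1 by lra.
have PX : P (X @^-1` A) = (((1 \in A)%:R + (-1 \in A)%:R) / 2)%:E.
  rewrite -[X @^-1` A]setIT sign_split// !setIT !QX q11 q1N qN1 qNN.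
  by rewrite -!EFinM -EFinD; congr EFin; lra.
have PY : P (Y @^-1` B) = (((1 \in B)%:R + (-1 \in B)%:R) / 2)%:E.
  rewrite -[Y @^-1` B]setIT sign_split// !setIT !QY q11 q1N qN1 qNN.
  by rewrite -!EFinM -EFinD; congr EFin; lra.
have XaB a : P (X @^-1` [set a] `&` Y @^-1` B) =
    ((1 \in B)%:R * q a 1 + (-1 \in B)%:R * q a (-1))%:E.
  rewrite setIC sign_split// (setIC (Y @^-1` [set 1])) qE.
  by rewrite (setIC (Y @^-1` [set -1])) qE -!EFinM -EFinD.
rewrite PX PY sign_split// !XaB q11 q1N qN1 qNN -!EFinM -EFinD.
by congr EFin; field.
Qed.

End fair_signs.

(** * The Walsh functions as random variables *)

Section walsh_variables.
Context {R : realType}.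

Definition walsh_fun k (x : measurableTypeR R) : R := walsh (rademacher x) k.

Lemma measurable_walsh_fun k : measurable_fun setT (walsh_fun k).
Proof.
apply: measurable_prod => l _; case: (bit k l); last exact: measurable_cst.
have sgnm : measurable_fun setT (fun t : nat => (-1) ^+ odd t : R) by [].
exact: (measurableT_comp sgnm (measurable_dyadic l.+1)).
Qed.

HB.instance Definition _ k :=
  isMeasurableFun.Build _ _ (measurableTypeR R) R (walsh_fun k)
    (measurable_walsh_fun k).

Definition walsh_RV k : {RV (unif : probability (measurableTypeR R) R) >-> R} :=
  walsh_fun k.

(** The squares of signs cancel, which leaves the positions where the digits of [i]
    and [j] differ. *)
Lemma walsh_funM i j : i <> j -> exists N (c : nat -> bool),
  (exists2 l, (l < N)%N & c l) /\
  forall x, walsh_fun i x * walsh_fun j x =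
    \prod_(l < N) rademacher x l ^+ c l.
Proof.
move=> ij; exists (maxn i j), (fun l => bit i l (+) bit j l); split.
  have lt2 k : (k <= maxn i j)%N -> (k < 2 ^ maxn i j)%N.
    by move=> kij; rewrite (leq_ltn_trans kij)// ltn_expl.
  have [l lN bl] :=
    bit_neq (lt2 i (leq_maxl i j)) (lt2 j (leq_maxr i j)) ij.
  by exists l => //; rewrite -negb_eqb.
move=> x; rewrite /walsh_fun (walsh_widen (maxn i j) _ i) ?leq_maxl//.
rewrite (walsh_widen (maxn i j) _ j) ?leq_maxr// -big_split/=.
apply: eq_bigr => l _; rewrite /rademacher.
by case: (bit i l); case: (bit j l);
  rewrite ?mulr1 ?mul1r//= expr1 -signr_addb addbb.
Qed.

Lemma unif_walsh_funM i j (b : bool) : i <> j ->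
  unif [set x | walsh_fun i x * walsh_fun j x = (-1) ^+ b] = (2^-1)%:E.
Proof.
move=> /walsh_funM[N [c [cN ijE]]].
by under eq_set do rewrite ijE; exact: unif_rademacher_prod.
Qed.

Lemma sign_valued_walsh k : sign_valued (walsh_RV k).
Proof.
move=> x; have [g gE] := rademacher_prod (R := R) (bit k) k.
by rewrite /= /walsh_fun/= /walsh gE; case: (g _); [right|left].
Qed.

(** Since [w_0 = 1], the law of [w_k] is that of the product [w_k w_0]. *)
Lemma fair_walsh k : k <> 0%N -> fair_sign (walsh_RV k).
Proof.
move=> k0; split.
- rewrite -(unif_walsh_funM k 0 false)//.
  by congr (unif _); apply/seteqP; split=> x /=;
    rewrite /walsh_fun/= walsh0 mulr1.
- rewrite -(unif_walsh_funM k 0 true)//.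
  by congr (unif _); apply/seteqP; split=> x /=;
    rewrite /walsh_fun/= walsh0 mulr1.
Qed.

(** The partial sum of length [n] is the Dirichlet kernel of length [n.+1] without
    its first term [w_0 = 1], which accounts for the extra 1 in the bound. *)
Lemma partial_sum_walsh_bounded (x : R) : 0 < x < 1 ->
  exists M, forall n, `|partial_sum (fun i => walsh_RV i.+1) n x| <= M.
Proof.
move=> /ex_odd_dyadic[m om]; exists (2 ^+ m.+1) => n.
have := @walsh_sum_bounded _ (rademacher x) m n.+1 (rademacher_norm x).
rewrite {1}/rademacher om => /(_ erefl).
rewrite big_ord_recl walsh0 /partial_sum => le1.
rewrite -[\sum_(i < n) _](addKr 1) (le_trans (ler_normD _ _))//.
by rewrite normrN normr1 addrC -lerBrDr.
Qed.

End walsh_variables.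

(** * Pairwise independent signs with bounded partial sums *)

Lemma measurable_sup_lty {d : measure_display} {T : measurableType d}
    {R : realType} (f : nat -> T -> R) :
  (forall n, measurable_fun setT (f n)) ->
  measurable [set w | (ereal_sup
    [set (f n w)%:E | n in [set n : nat | (1 <= n)%N]] < +oo)%E].
Proof.
move=> mf; rewrite -[X in measurable X]setTI.
(* The tail supremum from index 1 on is the supremum over [1 <= n]. *)
have mesups : measurable_fun setT (fun w => esups (fun n => (f n w)%:E) 1%N).
  by apply: measurable_fun_esups => n; apply/measurable_EFinP.
exact: (emeasurable_fun_infty_o measurableT mesups +oo%E).
Qed.

Theorem theorem1 (R : realType) :
  exists (d : measure_display) (T : measurableType d) (P : probability T R)
         (X : nat -> {RV P >-> R}),
    [/\ (forall i : nat, fair_sign (X i)),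
        pairwise_independent X &
        P [set w : T | (ereal_sup
             [set (`|partial_sum X n w|)%:E | n in [set n : nat | (1 <= n)%N]]
             < +oo)%E] = 1%E].
Proof.
exists _, _, unif, (fun i => walsh_RV i.+1); split.
- by move=> i; exact: fair_walsh.
- move=> i j ij; apply: independent_signs.
  + exact: sign_valued_walsh.
  + exact: sign_valued_walsh.
  + exact: fair_walsh.
  + exact: fair_walsh.
  + by apply: (unif_walsh_funM i.+1 j.+1 false) => -[].
- set S := [set w | _].
  have mS : measurable S.
    apply: (measurable_sup_lty (fun n w => `|partial_sum _ n w|)) => n.
    apply: measurableT_comp => //; apply: measurable_sum => i.
    exact: measurable_walsh_fun.
  apply/eqP; rewrite eq_le probability_le1//=.
  have <- : unif `]0, 1[%classic = 1%E :> \bar R.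
    rewrite unifE//= (setIidl (@subset_itv_oo_cc _ _ _ _))//.
    by rewrite lebesgue_measure_itv/= lte_fin ltr01 -EFinB subr0.
  apply: le_measure; rewrite ?inE// => x /=; rewrite in_itv/= => x01.
  have [M Mx] := partial_sum_walsh_bounded x x01.
  rewrite /S/=; apply: (@le_lt_trans _ _ M%:E); last by rewrite ltry.
  by apply: ge_ereal_sup => _ [n _ <-]; rewrite lee_fin.
Qed.
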